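(* For any $n\ge 5$, the $\mathbb{Z}_2$-lattice $\mathbb{H}^{n-1}\perp\langle 1,-1\rangle$ is primitively $n$-universal. In particular, $u^\ast_{\mathbb{Z}_2}(n) = 2n$ for any $n\ge 5$.
   Context: A $\mathbb{Z}_2$-lattice is a finitely generated $\mathbb{Z}_2$-submodule of a quadratic space $(V,B)$ over $\mathbb{Q}_2$, assumed integral ($B(L,L)\subseteq\mathbb{Z}_2$) and nondegenerate. A representation is a $\mathbb{Z}_2$-linear map preserving $B$; it is primitive if its image is a direct summand. A lattice is primitively $n$-universal if it primitively represents every $\mathbb{Z}_2$-lattice of rank $n$; $u^\ast_{\mathbb{Z}_2}(n)$ is the minimal rank of such a lattice. $\mathbb{H}$ is the binary lattice with Gram matrix $\begin{pmatrix}0&1\\1&0\end{pmatrix}$, $\mathbb{H}^{k}$ the orthogonal sum of $k$ copies, $\langle 1,-1\rangle$ the lattice with Gram matrix $\operatorname{diag}(1,-1)$. *)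

(* Defs.v *)
From HB Require Import structures.
From mathcomp Require Import all_boot all_order all_algebra.
From mathcomp Require Import boolp.
Set Implicit Arguments. Unset Strict Implicit. Unset Printing Implicit Defensive.
Import Order.TTheory GRing.Theory Num.Theory.
Local Open Scope ring_scope.

(* The ring Z_2 of 2-adic integers, built as the inverse limit of the rings  *)
(* Z / 2^k Z: an element is a sequence (x_k)_k of integers with             *)
(* x_k = x_{k+1} mod 2^k (hence 0 <= x_k < 2^k, the canonical residue).      *)

Definition pow2 (k : nat) : int := 2%:Z ^+ k.

Record Z2 := mkZ2 {
  z2f : nat -> int;
  z2_compat : forall k, z2f k = (z2f k.+1 %% pow2 k)%Z }.

Lemma z2_eq (x y : Z2) : z2f x = z2f y -> x = y.
Proof.
case: x y => [f hf] [g hg] /= efg; subst g.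
by rewrite (Prop_irrelevance hf hg).
Qed.

Lemma z2_mod (x : Z2) k : (z2f x k %% pow2 k)%Z = z2f x k.
Proof. by rewrite [in RHS]z2_compat [in LHS]z2_compat modz_mod. Qed.

Lemma modz_pow2S (m : int) k : ((m %% pow2 k.+1)%Z %% pow2 k)%Z = (m %% pow2 k)%Z.
Proof.
rewrite [in RHS](divz_eq m (pow2 k.+1)) /pow2 exprS mulrA.
by rewrite modzMDl.
Qed.

Lemma z2_compat_mod (x : Z2) k : (z2f x k.+1 %% pow2 k)%Z = z2f x k.
Proof. by rewrite -z2_compat. Qed.

Definition z2_norm (g : nat -> int)
  (hg : forall k, (g k.+1 %% pow2 k)%Z = (g k %% pow2 k)%Z) : Z2.
Proof.
refine (@mkZ2 (fun k => (g k %% pow2 k)%Z) _).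
by move=> k; rewrite modz_pow2S hg.
Defined.

Lemma z2_normE g hg k : z2f (@z2_norm g hg) k = (g k %% pow2 k)%Z.
Proof. by []. Qed.

Definition z2_zero : Z2.
Proof. refine (@mkZ2 (fun _ => 0) _). by move=> k; rewrite mod0z. Defined.

Definition z2_one : Z2.
Proof. refine (@z2_norm (fun _ => 1) _). by []. Defined.

Definition z2_add (x y : Z2) : Z2.
Proof.
refine (@z2_norm (fun k => z2f x k + z2f y k) _) => k.
by rewrite -modzDm !z2_compat_mod.
Defined.

Definition z2_opp (x : Z2) : Z2.
Proof.
refine (@z2_norm (fun k => - z2f x k) _) => k.
by rewrite -modzNm z2_compat_mod.
Defined.

Definition z2_mul (x y : Z2) : Z2.
Proof.
refine (@z2_norm (fun k => z2f x k * z2f y k) _) => k.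
by rewrite -modzMm !z2_compat_mod.
Defined.

HB.instance Definition _ := gen_eqMixin Z2.
HB.instance Definition _ := gen_choiceMixin Z2.

Lemma z2_addA : associative z2_add.
Proof.
move=> x y z; apply: z2_eq; apply: funext => k /=.
by rewrite modzDml modzDmr addrA.
Qed.

Lemma z2_addC : commutative z2_add.
Proof. by move=> x y; apply: z2_eq; apply: funext => k /=; rewrite addrC. Qed.

Lemma z2_add0 : left_id z2_zero z2_add.
Proof. by move=> x; apply: z2_eq; apply: funext => k /=; rewrite add0r z2_mod. Qed.

Lemma z2_addN : left_inverse z2_zero z2_opp z2_add.
Proof.
move=> x; apply: z2_eq; apply: funext => k /=.
by rewrite modzDml addNr mod0z.
Qed.

HB.instance Definition _ :=
  GRing.isZmodule.Build Z2 z2_addA z2_addC z2_add0 z2_addN.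

Lemma z2_mulA : associative z2_mul.
Proof.
move=> x y z; apply: z2_eq; apply: funext => k /=.
by rewrite modzMml modzMmr mulrA.
Qed.

Lemma z2_mulC : commutative z2_mul.
Proof. by move=> x y; apply: z2_eq; apply: funext => k /=; rewrite mulrC. Qed.

Lemma z2_mul1 : left_id z2_one z2_mul.
Proof.
by move=> x; apply: z2_eq; apply: funext => k /=; rewrite modzMml mul1r z2_mod.
Qed.

Lemma z2_mulDl : left_distributive z2_mul (@GRing.add Z2).
Proof.
move=> x y z; apply: z2_eq; apply: funext => k /=.
by rewrite modzMml modzDm mulrDl.
Qed.

Lemma z2_one_neq0 : z2_one != (0 : Z2).
Proof.
apply/eqP => /(congr1 (fun x => z2f x 1%N)) /=.
by rewrite modz_small.
Qed.

HB.instance Definition _ :=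
  GRing.Zmodule_isComNzRing.Build Z2 z2_mulA z2_mulC z2_mul1 z2_mulDl z2_one_neq0.

(* Z_2-lattices via Gram matrices.                                          *)
(* A nondegenerate Z_2-lattice of rank m is free, so it is given (up to      *)
(* isometry) by a symmetric Gram matrix B : 'M[Z2]_m w.r.t. a basis, with    *)
(* det B <> 0 (nondegenerate).  Integrality is automatic (entries in Z2).    *)

Definition Z2_lattice_gram (m : nat) (B : 'M[Z2]_m) : Prop :=
  B^T = B /\ \det B <> 0.

(* A Z_2-linear map Z2^n -> Z2^m, v |-> X v (X : 'M_(m,n)), is a            *)
(* representation of (Z2^n, A) by (Z2^m, B) iff it preserves the bilinear   *)
(* form, i.e. X^T B X = A.                                                  *)
Definition is_representation (m n : nat) (B : 'M[Z2]_m) (A : 'M[Z2]_n)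
  (X : 'M[Z2]_(m, n)) : Prop :=
  X^T *m B *m X = A.

(* The image of X is a direct summand of Z2^m: it is the image of an        *)
(* idempotent endomorphism E of Z2^m  (im X <= im E via E X = X, and         *)
(* im E <= im X via E = X S).                                               *)
Definition image_direct_summand (m n : nat) (X : 'M[Z2]_(m, n)) : Prop :=
  exists (E : 'M[Z2]_m) (S : 'M[Z2]_(n, m)),
    [/\ E *m E = E, E *m X = X & E = X *m S].

Definition prim_represents (m n : nat) (B : 'M[Z2]_m) (A : 'M[Z2]_n) : Prop :=
  exists X : 'M[Z2]_(m, n), is_representation B A X /\ image_direct_summand X.

Definition prim_n_universal (m : nat) (B : 'M[Z2]_m) (n : nat) : Prop :=
  forall A : 'M[Z2]_n, Z2_lattice_gram A -> prim_represents B A.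

Definition u_star_Z2_is (n r : nat) : Prop :=
  (exists B : 'M[Z2]_r, Z2_lattice_gram B /\ prim_n_universal B n) /\
  (forall (m : nat) (B : 'M[Z2]_m),
      Z2_lattice_gram B -> prim_n_universal B n -> (r <= m)%N).

Definition gram_H : 'M[Z2]_2 := \matrix_(i < 2, j < 2) (if i == j then 0 else 1).

Fixpoint gram_Hpow (k : nat) : 'M[Z2]_(k * 2) :=
  match k return 'M[Z2]_(k * 2) with
  | 0 => 0
  | k'.+1 => block_mx gram_H 0 0 (gram_Hpow k')
  end.

Definition gram_1m1 : 'M[Z2]_2 := \matrix_(i < 2, j < 2)
  (if i == j then (if i == 0 :> 'I_2 then 1 else -1) else 0).

Definition gram_main (n : nat) : 'M[Z2]_((n.-1) * 2 + 2) :=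
  block_mx (gram_Hpow n.-1) 0 0 gram_1m1.

(* Main.v *)
Require Import Defs.
From HB Require Import structures.
From mathcomp Require Import all_boot all_order all_algebra.
From mathcomp Require Import perm boolp ring.
Set Implicit Arguments. Unset Strict Implicit. Unset Printing Implicit Defensive.
Import Order.TTheory GRing.Theory Num.Theory.
Local Open Scope ring_scope.

(* The lattice has a basis p_0, ..., p_(n-1), q_0, ..., q_(n-1) whose only nonzero
   products are B(p_i, q_i) = 1 and B(q_0, q_0) = 1.  Mapping the i-th basis vector
   of the lattice with Gram matrix A to p_i + \sum_j R_(j, i) q_j is primitive, and
   it is a representation iff R + R^T + r^T r = A, where r is the row 0 of R.  This is
   solvable in R as soon as 1 + A_(0, 0) is a square, for instance if 8 divides
   A_(0, 0): the entry r_0 solves (r_0 + 1)^2 = 1 + A_(0, 0), the other r_j only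
   need the parity of A_(j, j), and the rest of R is then free.  A base change
   reduces to this case because in rank at least 5 some primitive vector v
   satisfies Q(v) = 0 mod 8.

   Conversely, let X be a primitive representation of 2^k I in a lattice of rank
   m < 2n with Gram matrix B and d = det B, and let S X = 1.  The 2n x 2n matrix
   [X^T B; S] [adj(B) S^T, X] = [d, 2^k; W, 1] factors through rank m, so
   det (d - 2^k W) = 0, which is impossible when k exceeds the valuation of d. *)

(** * Divisibility by powers of 2, parity and Hensel lifting in [Z2] *)

Lemma pow2_gt0 k : 0 < pow2 k.
Proof. by rewrite exprn_gt0. Qed.

Lemma pow2D j k : pow2 (j + k) = pow2 j * pow2 k.
Proof. by rewrite /pow2 exprD. Qed.

Lemma z2fD (x y : Z2) k : z2f (x + y) k = ((z2f x k + z2f y k) %% pow2 k)%Z.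
Proof. by []. Qed.

Lemma z2fM (x y : Z2) k : z2f (x * y) k = ((z2f x k * z2f y k) %% pow2 k)%Z.
Proof. by []. Qed.

Lemma z2f_exp2 k j : z2f (2 ^+ k) j = (pow2 k %% pow2 j)%Z.
Proof.
have z2f2 : z2f 2 j = (2 %% pow2 j)%Z by rewrite z2fD modzDm.
elim: k => [|k IH] //.
by rewrite exprS z2fM IH z2f2 modzMm -exprS.
Qed.

Lemma z2f_trunc (x : Z2) j k : (z2f x (j + k) %% pow2 j)%Z = z2f x j.
Proof.
elim: k => [|k IH]; first by rewrite addn0 z2_mod.
rewrite addnS -[RHS]IH -[z2f x (j + k)]z2_compat_mod.
rewrite [in LHS](divz_eq (z2f x (j + k).+1) (pow2 (j + k))).
by rewrite {2}pow2D (mulrC (pow2 j)) mulrA modzMDl.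
Qed.

Lemma z2f_exp2M_low k (y : Z2) : z2f (2 ^+ k * y) k = 0.
Proof. by rewrite z2fM z2f_exp2 modzz mul0r mod0z. Qed.

Lemma z2f_eq0P k (x : Z2) : z2f x k = 0 <-> exists y, x = 2 ^+ k * y.
Proof.
split=> [x0 | [y ->]]; last exact: z2f_exp2M_low.
have pk0 : pow2 k != 0 by rewrite gt_eqF ?pow2_gt0.
have dvd_k j : (pow2 k %| z2f x (k + j))%Z.
  by apply/dvdz_mod0P; rewrite z2f_trunc.
(* Division by 2^k loses k digits, so residue [j] of the quotient is read from residue [k + j] of
   [x]. *)
have compat j : ((z2f x (k + j.+1) %/ pow2 k)%Z %% pow2 j)%Z
              = ((z2f x (k + j) %/ pow2 k)%Z %% pow2 j)%Z.
  have e : (z2f x (k + j.+1) %% (pow2 k * pow2 j))%Z = z2f x (k + j).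
    by rewrite -pow2D addnS z2_compat_mod.
  have mE : z2f x (k + j.+1) = pow2 k * (z2f x (k + j.+1) %/ pow2 k)%Z.
    by rewrite mulrC divzK.
  by rewrite -e {2}mE -mulz_modr ?pow2_gt0 // mulKz // modz_mod.
exists (z2_norm compat); apply: z2_eq; apply: funext => j.
by rewrite z2fM z2f_exp2 z2_normE modzMm mulrC divzK // addnC z2f_trunc.
Qed.

Lemma z2f_eqP k (x y : Z2) :
  z2f x k = z2f y k <-> exists z, x = y + 2 ^+ k * z.
Proof.
split=> [exy | [z ->]]; last by rewrite z2fD z2f_exp2M_low addr0 z2_mod.
have /z2f_eq0P [z ez] : z2f (x - y) k = 0.
  by rewrite z2fD exy /= modzDmr subrr mod0z.
by exists z; rewrite -ez addrC subrK.
Qed.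

Lemma z2_parity (x : Z2) : exists y, x = 2 * y \/ x = 1 + 2 * y.
Proof.
have : z2f x 1 \in [:: 0; 1].
  have := ltz_pmod (z2f x 1) (pow2_gt0 1); have := modz_ge0 (z2f x 1) (lt0r_neq0 (pow2_gt0 1)).
  by rewrite z2_mod; case: (z2f x 1) => [[|[|?]]|].
rewrite !inE => /orP[]/eqP e.
- by have /z2f_eq0P [y ->] := e; exists y; left.
- have /z2f_eqP [y ->] : z2f x 1 = z2f 1 1 by rewrite e.
  by exists y; right.
Qed.

(** Cancelling 2 loses one digit: residue [k] of [x] is read from residue [k.+1] of [2 * x]. *)
Lemma z2_double_inj (x : Z2) : 2 * x = 0 -> x = 0.
Proof.
move=> x0; apply: z2_eq; apply: funext => k.
have : (2 * z2f x k.+1 %% pow2 k.+1)%Z = 0.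
  have : z2f (2 ^+ 1 * x) k.+1 = 0 by rewrite expr1 x0.
  by rewrite z2fM z2f_exp2 modzMml.
rewrite /pow2 exprS -mulz_modr // => /eqP; rewrite mulf_eq0 /= => /eqP.
by rewrite z2_compat_mod.
Qed.

Lemma z2_exp2_inj k (x : Z2) : 2 ^+ k * x = 0 -> x = 0.
Proof.
elim: k => [|k IH]; first by rewrite mul1r.
by rewrite exprS -mulrA => /z2_double_inj.
Qed.

Lemma z2_odd_neq_even (x y : Z2) : 1 + 2 * x <> 2 * y.
Proof.
move=> /(congr1 (fun z => z2f z 1)).
by rewrite z2fD -[2]expr1 !z2f_exp2M_low addr0.
Qed.

Lemma z2_odd_part (x : Z2) : x <> 0 ->
  exists (a : nat) (u : Z2), x = 2 ^+ a * (1 + 2 * u).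
Proof.
move=> x0.
(* The least index of a nonzero residue is positive, since residues mod 1 vanish; its predecessor
   [a] is the valuation of [x]. *)
have /ex_minnP [[|a] xa amin] : exists k, z2f x k != 0.
  apply: contrapT => h; apply: x0; apply: z2_eq; apply: funext => k /=.
  by apply/eqP; apply: contrapT => /negP ?; apply: h; exists k.
- by rewrite -z2_mod modz1 eqxx in xa.
have /z2f_eq0P [y xy] : z2f x a = 0.
  by apply/eqP; apply: contraT => /amin; rewrite ltnn.
exists a; have [u [yu|yu]] := z2_parity y; last by exists u; rewrite xy yu.
by rewrite xy yu mulrA -exprSr z2f_exp2M_low eqxx in xa.
Qed.

(* The iterates of [s |-> b - 2 s^2] converge 2-adically to the solution. *)
Lemma z2_hensel (b : Z2) : exists s : Z2, s + 2 * s ^+ 2 = b.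
Proof.
pose f (s : Z2) := b - 2 * s ^+ 2; pose T k := iter k f 0.
have f_contract k x y : z2f x k = z2f y k -> z2f (f x) k.+1 = z2f (f y) k.+1.
  move=> /z2f_eqP [z ->]; apply/z2f_eqP.
  exists (- (2 * y * z + 2 ^+ k * z ^+ 2)).
  by rewrite /f [2 ^+ k.+1]exprS; ring.
have T_compat k : z2f (T k) k = (z2f (T k.+1) k.+1 %% pow2 k)%Z.
  rewrite z2_compat_mod; elim: k => [|k IH]; last exact: f_contract.
  by rewrite -[LHS]z2_mod -[RHS]z2_mod !modz1.
pose s := mkZ2 T_compat.
have fs : f s = s.
  apply: z2_eq; apply: funext => -[|k].
    by rewrite -[LHS]z2_mod -[RHS]z2_mod !modz1.
  by rewrite (f_contract _ _ (T k)).
by exists s; rewrite -[X in X + _]fs /f; ring.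
Qed.

(** * Determinants and the lower bound on the rank *)

Lemma det_cong (R : comNzRingType) n (a : R) (M N : 'M[R]_n) :
  (forall i j, exists z, M i j = N i j + a * z) ->
  exists z, \det M = \det N + a * z.
Proof.
move=> MN; rewrite /determinant.
elim/big_ind2: _ => [|x1 x2 y1 y2 [z ->] [t ->]|s _].
- by exists 0; rewrite mulr0 addr0.
- by exists (z + t); rewrite mulrDr addrACA.
have [z ->] : exists z, \prod_i M i (s i) = \prod_i N i (s i) + a * z.
  elim/big_ind2: _ => [|x1 x2 y1 y2 [z ->] [t ->]|i _]; last exact: MN.
  - by exists 0; rewrite mulr0 addr0.
  - by exists (x1 * t + z * y1 + a * z * t); ring.
by exists ((-1) ^+ s * z); rewrite mulrDr mulrCA.
Qed.

(** Padding with zero columns and zero rows makes both factors square, and the first one then has a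
    zero column. *)
Lemma det_mul_thin (R : comNzRingType) m n (Y : 'M[R]_(m + n.+1, m)) Z :
  \det (Y *m Z) = 0.
Proof.
have -> : Y *m Z = row_mx Y (0 : 'M_(m + n.+1, n.+1)) *m col_mx Z 0.
  by rewrite mul_row_col mul0mx addr0.
rewrite det_mulmx (expand_det_col _ (rshift m ord0)) big1 ?mul0r // => i _.
by rewrite row_mxEr mxE mul0r.
Qed.

Lemma left_inverse_direct_summand m n (X : 'M[Z2]_(m, n)) (S : 'M[Z2]_(n, m)) :
  S *m X = 1%:M -> image_direct_summand X.
Proof.
move=> SX; exists (X *m S), S; split=> //.
- by rewrite mulmxA -(mulmxA X) SX mulmx1.
- by rewrite -mulmxA SX mulmx1.
Qed.

Lemma prim_n_universal_rank_ge m n (B : 'M[Z2]_m) :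
  Z2_lattice_gram B -> prim_n_universal B n -> (2 * n <= m)%N.
Proof.
move=> [Bsym /z2_odd_part [a [u dB]]] univ; rewrite leqNgt; apply/negP => lt_m.
(* One factor 2 more than in [\det B]: the matrix [d - c W] below is then [2 ^+ a] times a matrix
   congruent to 1 mod 2. *)
pose c : Z2 := 2 ^+ a.+1.
have c_inj x : c * x = 0 -> x = 0 by apply: z2_exp2_inj.
have cA : Z2_lattice_gram (c%:M : 'M[Z2]_n).
  split; first exact: tr_scalar_mx.
  rewrite det_scalar -exprM => h.
  have := @z2_exp2_inj (a.+1 * n) 1; rewrite mulr1 => /(_ h)/eqP.
  by rewrite oner_eq0.
have [X [XBX [E [S [_ EX ES]]]]] := univ _ cA.
(* As [X S = E] and [E X = X], the product [X^T B X S X] equals [X^T B X]. This reads [c S X = c],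
   and [c] cancels. *)
have SX : S *m X = 1%:M.
  apply/matrixP => i j; apply/eqP; rewrite -subr_eq0; apply/eqP/c_inj.
  have : c%:M *m (S *m X) = c%:M.
    by rewrite -{1}XBX -!mulmxA (mulmxA X S) -ES EX mulmxA XBX.
  move=> /matrixP /(_ i j); rewrite mul_scalar_mx mxE [RHS]mxE => e.
  by rewrite mulrBr e mxE mulr_natr subrr.
pose d := \det B.
pose Y := col_mx (X^T *m B) S.
pose W := S *m \adj B *m S^T.
pose Z := row_mx (\adj B *m S^T) X.
have YZ : Y *m Z = block_mx d%:M c%:M W 1%:M.
  rewrite mul_col_row SX XBX mulmxA -(mulmxA _ B) mul_mx_adj mul_mx_scalar.
  by rewrite -scalemxAl -trmx_mul SX trmx1 scalemx1 [S *m (_ *m _)]mulmxA.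
have det0 : \det (d%:M - c *: W) = 0.
  (* Subtracting [c] times the second block row clears the upper right block. *)
  have : \det (block_mx 1%:M (- c%:M) 0 1%:M *m block_mx d%:M c%:M W 1%:M) = 0.
    rewrite det_mulmx -YZ.
    have -> : \det (Y *m Z) = 0; last by rewrite mulr0.
    have [k e] : exists k, (n + n = m + k.+1)%N.
      exists (n + n - m).-1; rewrite mul2n -addnn in lt_m.
      by rewrite prednK ?subn_gt0 // subnKC // ltnW.
    move: Y Z {YZ}; rewrite e => Y Z; exact: det_mul_thin.
  rewrite mulmx_block !mul1mx mulmx1 !mul0mx addrN !add0r det_lblock det1 mulr1.
  by rewrite mulNmx mul_scalar_mx.
have [z detE] : exists z, \det ((1 + 2 * u)%:M - 2 *: W) = \det (1%:M : 'M_n) + 2 * z.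
  apply: det_cong => i j; exists (u *+ (i == j) - W i j).
  by rewrite !mxE mulrnDl -mulrnAr; ring.
have : 2 ^+ a *: ((1 + 2 * u)%:M - 2 *: W) = d%:M - c *: W.
  by rewrite scalerBr scale_scalar_mx scalerA -exprSr /d dB.
move=> /(congr1 determinant); rewrite det0 detZ -exprM => /z2_exp2_inj.
rewrite detE det1 => h.
by apply: (@z2_odd_neq_even z 0); rewrite h mulr0.
Qed.

(** * Primitive vectors of norm divisible by 8 in rank at least 5 *)

Definition bform n (A : 'M[Z2]_n) (u v : 'cV[Z2]_n) : Z2 :=
  (u^T *m A *m v) 0 0.

Notation qform A v := (bform A v v).

Lemma bformDl n (A : 'M[Z2]_n) u v w :
  bform A (u + v) w = bform A u w + bform A v w.
Proof. by rewrite /bform linearD !mulmxDl mxE. Qed.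

Lemma bformDr n (A : 'M[Z2]_n) u v w :
  bform A u (v + w) = bform A u v + bform A u w.
Proof. by rewrite /bform mulmxDr mxE. Qed.

Lemma bformZl n (A : 'M[Z2]_n) a u v : bform A (a *: u) v = a * bform A u v.
Proof. by rewrite /bform linearZ -!scalemxAl mxE. Qed.

Lemma bformZr n (A : 'M[Z2]_n) a u v : bform A u (a *: v) = a * bform A u v.
Proof. by rewrite /bform -!scalemxAr mxE. Qed.

Lemma bform0l n (A : 'M[Z2]_n) v : bform A 0 v = 0.
Proof. by rewrite /bform trmx0 !mul0mx mxE. Qed.

Lemma bformC n (A : 'M[Z2]_n) u v : A^T = A -> bform A u v = bform A v u.
Proof.
move=> symA; rewrite /bform -[u^T *m _ *m _]trmxK mxE.
by rewrite !trmx_mul trmxK symA mulmxA.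
Qed.

Lemma bform_delta n (A : 'M[Z2]_n) i j :
  bform A (delta_mx i 0) (delta_mx j 0) = A i j.
Proof. by rewrite /bform trmx_delta -rowE -colE !mxE. Qed.

Definition bformE := (bformDl, bformDr, bformZl, bformZr, bform_delta).

Lemma qform_even n (A : 'M[Z2]_n) (v : 'cV_n) : A^T = A ->
  (forall i, exists h, A i i = 2 * h) -> exists h, qform A v = 2 * h.
Proof.
move=> symA diagA; rewrite (matrix_sum_delta v).
have qD u w : (exists h, qform A u = 2 * h) -> (exists h, qform A w = 2 * h) ->
    exists h, qform A (u + w) = 2 * h.
  move=> [h uE] [k wE]; exists (h + k + bform A u w).
  by rewrite !bformE uE wE (bformC w u symA); ring.
have q0 : exists h, qform A 0 = 2 * h by exists 0; rewrite bform0l mulr0.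
elim/big_ind: _ => // i _; elim/big_ind: _ => // j _.
have [h hE] := diagA i; exists (v i j ^+ 2 * h).
by rewrite !bformE ord1 bform_delta hE; ring.
Qed.

Lemma bform_suml_even n (A : 'M[Z2]_n) k (c : 'I_k -> Z2) (f : 'I_k -> 'cV_n) w :
  (forall l, exists h, bform A (f l) w = 2 * h) ->
  exists h, bform A (\sum_l c l *: f l) w = 2 * h.
Proof.
move=> fw; elim/big_ind: _ => [|u v [h uE] [k' vE]|l _].
- by exists 0; rewrite bform0l mulr0.
- by exists (h + k'); rewrite bformDl uE vE mulrDr.
- by have [h hE] := fw l; exists (c l * h); rewrite bformZl hE mulrCA.
Qed.

(* A ternary quadratic form over F_2 is isotropic. *)
Lemma ternary_isotropic_mod2 (h0 h1 h2 x01 x02 x12 : Z2) :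
  exists c0 c1 c2, (c0 = 1 \/ c1 = 1 \/ c2 = 1) /\
    exists y, c0 ^+ 2 * h0 + c1 ^+ 2 * h1 + c2 ^+ 2 * h2
      + c0 * c1 * x01 + c0 * c2 * x02 + c1 * c2 * x12 = 2 * y.
Proof.
have [h0' [->|->]] := z2_parity h0.
  by exists 1, 0, 0; split; [left | exists h0'; ring].
have [h1' [->|->]] := z2_parity h1.
  by exists 0, 1, 0; split; [right; left | exists h1'; ring].
have [h2' [->|->]] := z2_parity h2.
  by exists 0, 0, 1; split; [right; right | exists h2'; ring].
have [x01' [->|->]] := z2_parity x01.
  by exists 1, 1, 0; split; [left | exists (1 + h0' + h1' + x01'); ring].
have [x02' [->|->]] := z2_parity x02.
  by exists 1, 0, 1; split; [left | exists (1 + h0' + h2' + x02'); ring].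
have [x12' [->|->]] := z2_parity x12.
  by exists 0, 1, 1; split; [right; left | exists (1 + h1' + h2' + x12'); ring].
exists 1, 1, 1; split; [by left |].
by exists (3 + h0' + h1' + h2' + x01' + x02' + x12'); ring.
Qed.

(** The factor [2 * a] comes out of every term and leaves an integral ternary quadratic form, which
    has a nontrivial zero mod 2. The lemma serves for [a = 1] and [a = 2]. *)
Lemma qform_ternary n (A : 'M[Z2]_n) (a : Z2) (f : 'I_3 -> 'cV_n) : A^T = A ->
  (forall k, exists h, qform A (f k) = 2 * a * h) ->
  (forall k l, k != l -> exists x, bform A (f k) (f l) = a * x) ->
  exists c : 'I_3 -> Z2, (exists k, c k = 1) /\
    exists y, qform A (\sum_k c k *: f k) = 4 * a * y.
Proof.
move=> symA qf bf; pose i1 : 'I_3 := lift ord0 ord0; pose i2 : 'I_3 := ord_max.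
have [[h0 q0] [h1 q1] [h2 q2]] := And3 (qf ord0) (qf i1) (qf i2).
have [x01 b01] := bf ord0 i1 isT; have [x02 b02] := bf ord0 i2 isT.
have [x12 b12] := bf i1 i2 isT.
have [c0 [c1 [c2 [c_eq1 [y yE]]]]] := ternary_isotropic_mod2 h0 h1 h2 x01 x02 x12.
exists (fun k => [:: c0; c1; c2]`_k); split.
  by case: c_eq1 => [->|[->|->]]; [exists ord0 | exists i1 | exists i2].
exists y; rewrite !big_ord_recl big_ord0 addr0 /=.
have -> : lift ord0 (lift ord0 ord0) = i2 by apply: val_inj.
have -> : 4 * a * y = 2 * a * (2 * y) by ring.
rewrite -yE !bformE -/i1 (bformC (f i1) (f ord0)) // (bformC (f i2) (f ord0)) //.
rewrite (bformC (f i2) (f i1)) // q0 q1 q2 b01 b02 b12.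
by ring.
Qed.

(** A vector of odd norm, if there is one, is added to the others of odd norm. This leaves three
    vectors of even norm, and the ternary case applies with [a = 1]. *)
Lemma qform_quaternary n (A : 'M[Z2]_n) (f : 'I_4 -> 'cV_n) : A^T = A ->
  exists c : 'I_4 -> Z2, (exists k, c k = 1) /\
    exists y, qform A (\sum_k c k *: f k) = 4 * y.
Proof.
move=> symA.
have [p [e g_even]] : exists (p : 'I_4) (e : 'I_3 -> Z2), forall k,
    exists h, qform A (f (lift p k) + e k *: f p) = 2 * h.
  have [[p [h ph]]|no_odd] :=
      pselect (exists p, exists h, qform A (f p) = 1 + 2 * h).
    have ex_e k : exists e h, qform A (f (lift p k) + e *: f p) = 2 * h.
      have [h' [kh'|kh']] := z2_parity (qform A (f (lift p k))).
        by exists 0, h'; rewrite scale0r addr0.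
      exists 1, (1 + h + h' + bform A (f (lift p k)) (f p)).
      by rewrite !bformE (bformC (f p) _ symA) kh' ph; ring.
    by have [e eP] := choice ex_e; exists p, e.
  exists ord0, (fun=> 0) => k; rewrite scale0r addr0.
  have [h [hE|hE]] := z2_parity (qform A (f (lift ord0 k))); first by exists h.
  by case: no_odd; exists (lift ord0 k), h.
pose g k := f (lift p k) + e k *: f p.
have [||c [[k ck] [y yE]]] := @qform_ternary _ A 1 g symA.
- by move=> k; have [h hE] := g_even k; exists h; rewrite mulr1.
- by move=> k l _; exists (bform A (g k) (g l)); rewrite mul1r.
(* In terms of the [f i], the coefficient of [f p] collects all corrections; the others, among them
   the coefficient 1, are unchanged. *)
exists (fun i => if unlift p i is Some k then c k else \sum_k c k * e k).
split; first by exists (lift p k); rewrite liftK.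
exists y; rewrite mulr1 in yE; rewrite -yE.
congr (bform A _ _); rewrite (bigD1_ord p) //= unlift_none scaler_suml;
  rewrite -big_split /=; apply: eq_bigr => l _;
  by rewrite liftK addrC /g scalerDr scalerA.
Qed.

(** The [w j] vanish at the selected coordinates, so coefficients can be read off there; a
    coefficient 1 shows that the combination is primitive. *)
Lemma coord_sum_delta n k (idx : 'I_k -> 'I_n) (c : 'I_k -> Z2)
    (w : 'I_k -> 'cV_n) l :
  injective idx -> (forall j, w j (idx l) 0 = 0) ->
  (\sum_j c j *: (delta_mx (idx j) 0 + w j)) (idx l) 0 = c l.
Proof.
move=> idx_inj w0; rewrite summxE (bigD1 l) //= !mxE w0 addr0 !eqxx mulr1.
rewrite big1 ?addr0 // => j /negPf jl.
by rewrite !mxE w0 addr0 (inj_eq idx_inj) eq_sym jl mulr0.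
Qed.

(* Q(v + 2w) = Q(v) + 4 (B(v, w) + Q(w)), so w corrects Q(v) = 4 mod 8. *)
Lemma qform_mod8_lift n (A : 'M[Z2]_n) i (v w : 'cV_n) h s : A^T = A ->
  v i 0 = 1 -> w i 0 = 0 -> qform A v = 4 * h ->
  bform A v w + qform A w = 1 + 2 * s ->
  exists v' : 'cV_n, v' i 0 = 1 /\ exists y, qform A v' = 8 * y.
Proof.
move=> symA vi wi vh vw; have [h' [hE|hE]] := z2_parity h.
  by exists v; split=> //; exists h'; rewrite vh hE; ring.
exists (v + 2 *: w); rewrite !mxE vi wi mulr0 addr0; split=> //.
exists (1 + h' + s).
have -> : 8 * (1 + h' + s) = 4 * (1 + 2 * h') + 4 * (1 + 2 * s) by ring.
by rewrite -vw -hE -vh !bformE (bformC w v symA); ring.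
Qed.

(** The vectors [f k] are orthogonal to [e_i] mod 2 because [A i i] is odd. A combination [v] of
    four of them has Q(v) = 0 mod 4, and [w = e_i] can correct it mod 8, since B(v, w) + Q(w) is
    odd. *)
Lemma qform_mod8_odd m (A : 'M[Z2]_(5 + m)) i h : A^T = A -> A i i = 1 + 2 * h ->
  exists (v : 'cV_(5 + m)) j, v j 0 = 1 /\ exists y, qform A v = 8 * y.
Proof.
move=> symA Aii; pose idx (k : 'I_4) : 'I_(5 + m) := lift i (lshift m k : 'I_(4 + m)).
have idx_inj : injective idx by move=> k l /lift_inj/(@lshift_inj 4 m).
have idx_i k : (idx k == i) = false by rewrite eq_sym (negbTE (neq_lift _ _)).
pose f k : 'cV[Z2]_(5 + m) := delta_mx (idx k) 0 + A (idx k) i *: delta_mx i 0.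
have fi k : exists r, bform A (f k) (delta_mx i 0) = 2 * r.
  by exists (A (idx k) i * (1 + h)); rewrite !bformE Aii; ring.
have [c [[k ck] [y yE]]] := qform_quaternary f symA.
have [r rE] := bform_suml_even c fi.
have vk : (\sum_k c k *: f k) (idx k) 0 = 1.
  by rewrite coord_sum_delta // => j; rewrite !mxE idx_i mulr0.
have := @qform_mod8_lift _ A (idx k) _ (delta_mx i 0) y (r + h) symA vk.
rewrite mxE idx_i rE bform_delta Aii => /(_ erefl yE) [|v [vi vy]]; first by ring.
by exists v, (idx k).
Qed.

(* With Q = 2q, the lemma [qform_mod8_lift] applies to any v with q(v) even that is
   not in the radical mod 2.  If there is none, then q is odd on e_i, e_j and even
   on the vectors f orthogonal mod 2 to both, since e_i + f is not radical; so the
   form q / 2 on three such f is integral and has a zero mod 2. *)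
Lemma qform_mod8_even_odd m (A : 'M[Z2]_(5 + m)) i j s : A^T = A ->
  (forall k, exists h, A k k = 2 * h) -> A i j = 1 + 2 * s ->
  exists (v : 'cV_(5 + m)) k, v k 0 = 1 /\ exists y, qform A v = 8 * y.
Proof.
move=> symA evA Aij; apply: contrapT => none.
have symAE k l : A k l = A l k by rewrite -[in LHS]symA mxE.
have i_neq_j : i != j.
  apply/eqP => eij; have [h] := evA i.
  by rewrite {2}eij Aij; apply: z2_odd_neq_even.
have key k (v w : 'cV_(5 + m)) r : v k 0 = 1 -> w k 0 = 0 ->
    bform A v w = 1 + 2 * r -> exists h, qform A v = 2 + 4 * h.
  move=> vk wk vw; have [q qE] := qform_even v symA evA.
  have [t tE] := qform_even w symA evA.
  have [h [hE|hE]] := z2_parity q; last by exists h; rewrite qE hE; ring.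
  case: none; have := @qform_mod8_lift _ A k v w h (r + t) symA vk wk.
  rewrite qE hE vw tE => /(_ _ _) [||v' [v'k v'y]]; [by ring | by ring |].
  by exists v', k.
have [a aE] : exists a, A i i = 2 + 4 * a.
  have := key i (delta_mx i 0) (delta_mx j 0) s; rewrite !mxE !bformE !eqxx.
  by rewrite (negPf i_neq_j); apply.
have [j' jE] : exists j' : 'I_(4 + m), j = lift i j'.
  by case: (unliftP i j) i_neq_j => [j' ->|->]; [exists j' | rewrite eqxx].
pose idx (k : 'I_3) : 'I_(5 + m) := lift i (lift j' (lshift m k : 'I_(3 + m))).
have idx_inj : injective idx by move=> k l /lift_inj/lift_inj/(@lshift_inj 3 m).
have idx_i k : (idx k == i) = false by rewrite eq_sym (negbTE (neq_lift _ _)).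
have idx_j k : (idx k == j) = false.
  by rewrite jE eq_sym (inj_eq lift_inj) (negbTE (neq_lift _ _)).
(* Mod 2 the vectors [e_i], [e_j] span a hyperbolic plane, and [f k] is the basis vector minus its
   component in that plane; signs do not matter mod 2. *)
pose f k : 'cV[Z2]_(5 + m) := delta_mx (idx k) 0 +
  (A (idx k) j *: delta_mx i 0 + A (idx k) i *: delta_mx j 0).
have fi k : exists r, bform A (f k) (delta_mx i 0) = 2 * r.
  exists (A (idx k) j * (1 + 2 * a) + A (idx k) i * (1 + s)).
  by rewrite !bformE aE (symAE j) Aij; ring.
have [b bE] := evA j.
have fj k : exists r, bform A (f k) (delta_mx j 0) = 2 * r.
  exists (A (idx k) j * (1 + s) + A (idx k) i * b).
  by rewrite !bformE bE Aij; ring.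
have keyF k (v : 'cV_(5 + m)) : v (idx k) 0 = 1 ->
    (exists r, bform A v (delta_mx i 0) = 2 * r) ->
    (exists r, bform A v (delta_mx j 0) = 2 * r) -> exists h, qform A v = 4 * h.
  move=> vk [r ri] [t tj]; have [q qE] := qform_even v symA evA.
  have [h [hE|hE]] := z2_parity q; first by exists h; rewrite qE hE; ring.
  have := key (idx k) (delta_mx i 0 + v) (delta_mx j 0) (s + t).
  rewrite !mxE idx_i idx_j vk !bformE (bformC (delta_mx i 0) v symA) ri tj aE qE hE Aij.
  case=> [||| z]; [by rewrite add0r | by [] | by ring | move=> e].
  case: (@z2_odd_neq_even z (1 + a + h + r)); apply/eqP; rewrite -subr_eq0.
  apply/eqP/z2_double_inj; move/eqP: e; rewrite eq_sym -subr_eq0 => /eqP <-.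
  by ring.
have f_idx l k : f l (idx k) 0 = (k == l)%:R.
  by rewrite !mxE idx_i idx_j !mulr0 !addr0 (inj_eq idx_inj) andbT.
have qf k : exists h, qform A (f k) = 2 * 2 * h.
  have [] // := keyF k (f k); first by rewrite f_idx eqxx.
  by move=> h hE; exists h; rewrite hE; ring.
(* By polarization: 4 divides the norms of [f k], [f l] and [f k + f l], hence also twice the
   product. *)
have bf k l : k != l -> exists x, bform A (f k) (f l) = 2 * x.
  move=> kl; have [h hE] := qf k; have [h' h'E] := qf l.
  have [|||z] := keyF k (f k + f l).
  - by rewrite mxE !f_idx eqxx (negPf kl) addr0.
  - have [r rE] := fi k; have [t tE] := fi l.
    by exists (r + t); rewrite bformDl rE tE mulrDr.
  - have [r rE] := fj k; have [t tE] := fj l.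
    by exists (r + t); rewrite bformDl rE tE mulrDr.
  rewrite bformDl (bformDr _ (f k) (f k)) (bformDr _ (f l) (f k)).
  rewrite (bformC (f l) (f k) symA) hE h'E => e.
  exists (z - h - h'); apply/eqP; rewrite -subr_eq0; apply/eqP/z2_double_inj.
  by move/eqP: e; rewrite -subr_eq0 => /eqP <-; ring.
have [c [[k ck] [y yE]]] := qform_ternary symA qf bf.
apply: none; exists (\sum_k c k *: f k), (idx k); split.
  by rewrite coord_sum_delta // => l; rewrite !mxE idx_i idx_j !mulr0 addr0.
by exists y; rewrite yE; ring.
Qed.

(** If neither the diagonal nor the rest of [A] has an odd entry, then [A = 2 A'], and a norm
    divisible by 4 for [A'] is enough; four basis vectors provide it. *)
Lemma qform_mod8 m (A : 'M[Z2]_(5 + m)) : A^T = A ->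
  exists (v : 'cV_(5 + m)) k, v k 0 = 1 /\ exists y, qform A v = 8 * y.
Proof.
move=> symA.
have [[i [h hE]]|noodd] := pselect (exists i h, A i i = 1 + 2 * h).
  exact: qform_mod8_odd hE.
have evA i : exists h, A i i = 2 * h.
  have [h [hE|hE]] := z2_parity (A i i); first by exists h.
  by case: noodd; exists i, h.
have [[i [j [h hE]]]|noodd'] := pselect (exists i j h, A i j = 1 + 2 * h).
  exact: qform_mod8_even_odd evA hE.
have ex_A' (ij : 'I_(5 + m) * 'I_(5 + m)) : exists h, A ij.1 ij.2 = 2 * h.
  have [h [hE|hE]] := z2_parity (A ij.1 ij.2); first by exists h.
  by case: noodd'; exists ij.1, ij.2, h.
have [a aE] := choice ex_A'; pose A' := \matrix_(i, j) a (i, j).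
have AE : A = 2 *: A' by apply/matrixP => i j; rewrite !mxE -aE.
have symA' : A'^T = A'.
  apply/matrixP => i j; apply/eqP; rewrite -subr_eq0; apply/eqP/z2_double_inj.
  by rewrite !mxE mulrBr -!aE /= -[in A j i]symA mxE subrr.
pose idx (k : 'I_4) : 'I_(5 + m) := lift ord0 (lshift m k : 'I_(4 + m)).
have idx_inj : injective idx by move=> k l /lift_inj/(@lshift_inj 4 m).
have [c [[k ck] [y yE]]] :=
  qform_quaternary (fun k => delta_mx (idx k) 0 + 0) symA'.
exists (\sum_k c k *: (delta_mx (idx k) 0 + 0)), (idx k); split.
  by rewrite coord_sum_delta // => l; rewrite mxE.
by exists y; rewrite AE /bform -scalemxAr -scalemxAl mxE [X in _ * X]yE; ring.
Qed.

(** * From a vector of norm divisible by 8 to a primitive representation *)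

Lemma basis_with_first_vector n (v : 'cV[Z2]_n.+1) k : v k 0 = 1 ->
  exists U V : 'M[Z2]_n.+1, U *m V = 1%:M /\ U *m delta_mx 0 0 = v.
Proof.
move=> vk; pose e : 'cV[Z2]_n.+1 := delta_mx k 0; pose w := v - e.
pose s : 'M[Z2]_n.+1 := tperm_mx k 0.
have we : e^T *m w = 0.
  apply/matrixP => i j; rewrite trmx_delta -rowE !mxE !ord1 vk !eqxx.
  exact: subrr.
have ss : s *m s = 1%:M by rewrite -perm_mxM tperm2 perm_mx1.
(* The transposition [s] sends [e_0] to [e_k], and the transvection [1 + w e^T] sends [e_k] to [v].
   Its inverse is [1 - w e^T] because [e^T w = 0]. *)
exists ((1%:M + w *m e^T) *m s), (s *m (1%:M - w *m e^T)); split.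
  rewrite mulmxA -(mulmxA _ s s) ss mulmx1 mulmxDl mul1mx mulmxBr mulmx1.
  by rewrite -(mulmxA w) (mulmxA e^T) we mul0mx mulmx0 subr0 subrK.
have se : s *m delta_mx 0 0 = e.
  apply/matrixP => i j; rewrite -colE !mxE ord1 eqxx andbT.
  by rewrite -(inj_eq (@perm_inj _ (tperm k 0))) tpermK tpermR.
have ee : e^T *m e = 1%:M.
  apply/matrixP => i j; rewrite trmx_delta -rowE !mxE !ord1.
  by rewrite !eqxx.
by rewrite -mulmxA se mulmxDl mul1mx -mulmxA ee mulmx1 addrC subrK.
Qed.

(** The substitution [r = 4 s] and division by 8 give [s + 2 s^2 = y]. *)
Lemma shifted_sqrt_8 (y : Z2) : exists r, 2 * r + r ^+ 2 = 8 * y.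
Proof. by have [s <-] := z2_hensel y; exists (4 * s); ring. Qed.

Lemma half_gram n (A : 'M[Z2]_n.+1) y : A^T = A -> A 0 0 = 8 * y ->
  exists R : 'M[Z2]_n.+1, R + R^T + R^T *m delta_mx 0 0 *m R = A.
Proof.
move=> symA A00.
have symAE k l : A k l = A l k by rewrite -[in LHS]symA mxE.
(* Here [p.1] is [r_i] and [p.2] the diagonal entry of [R]; they agree at [i = 0], where that entry
   lies in row 0. *)
have ex_rho i : exists p : Z2 * Z2, A i i = 2 * p.2 + p.1 ^+ 2 /\ (i = 0 -> p.1 = p.2).
  have [-> | i0] := eqVneq i 0.
    by have [r rE] := shifted_sqrt_8 y; exists (r, r); rewrite A00 rE.
  have [h [hE|hE]] := z2_parity (A i i).
    by exists (0, h); split=> [|e]; [rewrite hE /=; ring | rewrite e eqxx in i0].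
  by exists (1, h); split=> [|e]; [rewrite hE /=; ring | rewrite e eqxx in i0].
have [p pE] := choice ex_rho; pose r i := (p i).1.
(* Row 0 is [r]. Column 0 and the entries above the diagonal absorb the rest of [A], so the other
   entries below the diagonal can be 0. *)
pose R : 'M[Z2]_n.+1 := \matrix_(i, j) if i == 0 then r j else
  if j == 0 then A i 0 - r i - r i * r 0 else
  if i == j then (p i).2 else if (i < j)%N then A i j - r i * r j else 0.
exists R; apply/matrixP => i j.
have -> : R^T *m delta_mx 0 0 *m R = (row 0 R)^T *m row 0 R.
  have <- : (delta_mx 0 0 : 'rV[Z2]_n.+1)^T *m delta_mx 0 0 =
      delta_mx 0 0 :> 'M_n.+1.
    by rewrite trmx_delta mul_delta_mx.
  by rewrite rowE trmx_mul !mulmxA.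
rewrite !mxE big_ord1 !mxE eqxx.
have [pi p0i] := pE i; have [_ p0j] := pE j.
have [ei | i0] := eqVneq i 0; have [ej | j0] := eqVneq j 0.
- by rewrite ei ej in pi p0i *; rewrite pi -p0i // /r; ring.
- by rewrite ei (symAE 0); ring.
- by rewrite ej; ring.
rewrite (eq_sym j i); have [<- | ij] := eqVneq i j; first by rewrite pi /r; ring.
case: (ltngtP i j) => [_ | _ | /val_inj e]; last by rewrite e eqxx in ij.
- by ring.
- by rewrite (symAE i); ring.
Qed.

Lemma hyperbolic_frame_represents m n (G : 'M[Z2]_m) (P Q : 'M[Z2]_(m, n.+1))
    (A : 'M[Z2]_n.+1) y :
  G^T = G -> P^T *m G *m P = 0 -> P^T *m G *m Q = 1%:M ->
  Q^T *m G *m Q = delta_mx 0 0 -> A^T = A -> A 0 0 = 8 * y ->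
  exists X S, is_representation G A X /\ S *m X = 1%:M.
Proof.
move=> symG PP PQ QQ symA A00; have [R RE] := half_gram symA A00.
have QP : Q^T *m G *m P = 1%:M.
  by apply: trmx_inj; rewrite !trmx_mul trmxK symG mulmxA PQ trmx1.
(* For [X = P + Q R], one has [P^T G X = R] and [Q^T G X = 1 + delta_mx 0 0 R], which makes the
   second witness a left inverse. *)
exists (P + Q *m R), (Q^T *m G - delta_mx 0 0 *m P^T *m G); split; last first.
  rewrite mulmxBl !mulmxDr !mulmxA QP QQ -!(mulmxA (delta_mx 0 0)) PP PQ.
  by rewrite mulmx0 mul1mx add0r addrK.
have trX : (P + Q *m R)^T = P^T + R^T *m Q^T by rewrite -trmx_mul raddfD.
rewrite /is_representation trX !mulmxDl !mulmxDr !mulmxA.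
rewrite PP PQ -!(mulmxA R^T) QP QQ mul1mx mulmx1 add0r -[RHS]RE.
by rewrite !mulmxA addrA.
Qed.

(** In a basis [U] starting with [v], the corner of the Gram matrix is Q(v). A representation [X] of
    [U^T A U] then gives [X V] for [A], where [V] inverts [U]. *)
Lemma hyperbolic_frame_universal m n (G : 'M[Z2]_m) (P Q : 'M[Z2]_(m, 5 + n)) :
  G^T = G -> P^T *m G *m P = 0 -> P^T *m G *m Q = 1%:M ->
  Q^T *m G *m Q = delta_mx 0 0 -> prim_n_universal G (5 + n).
Proof.
move=> symG PP PQ QQ A [symA _].
have [v [k [vk [y vy]]]] := qform_mod8 symA.
have [U [V [UV Uv]]] := basis_with_first_vector vk.
have symA' : (U^T *m A *m U)^T = U^T *m A *m U.
  by rewrite !trmx_mul trmxK symA mulmxA.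
have A'00 : (U^T *m A *m U) 0 0 = 8 * y.
  by rewrite -vy -Uv -bform_delta /bform trmx_mul !mulmxA.
have [X [S [XGX SX]]] := hyperbolic_frame_represents symG PP PQ QQ symA' A'00.
exists (X *m V); split; last first.
  apply: (@left_inverse_direct_summand _ _ _ (U *m S)).
  by rewrite mulmxA -(mulmxA U) SX mulmx1.
rewrite /is_representation trmx_mul !mulmxA -(mulmxA _ X^T) -(mulmxA _ _ X) XGX.
rewrite !mulmxA -trmx_mul UV trmx1 mul1mx -mulmxA UV.
by rewrite mulmx1.
Qed.

(** * The basis of the p_i and q_i, and nondegeneracy of [gram_main] *)

Lemma delta_gram n (M : 'M[Z2]_n) i j :
  (delta_mx i 0)^T *m M *m delta_mx j 0 = (M i j)%:M :> 'M_1.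
Proof.
by apply/matrixP => k l; rewrite !ord1 -[LHS]/(bform M _ _) bform_delta mxE.
Qed.

Lemma block_gram m1 m2 n1 n2 (G1 : 'M[Z2]_m1) (G2 : 'M[Z2]_m2)
    (a b : 'M[Z2]_(m1, n1)) (c d : 'M[Z2]_(m2, n2)) :
  (block_mx a 0 0 c)^T *m block_mx G1 0 0 G2 *m block_mx b 0 0 d =
  block_mx (a^T *m G1 *m b) 0 0 (c^T *m G2 *m d).
Proof.
rewrite tr_block_mx !mulmx_block !trmx0.
by rewrite !(mul0mx, mulmx0, addr0, add0r).
Qed.

(** The size [m] is generic for the block computations; for [gram_Hpow], [k.+1 * 2] and [2 + k * 2]
    agree by conversion. *)
Lemma hyperbolic_frame_cons m k (G : 'M[Z2]_m) (P Q : 'M[Z2]_(m, k)) :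
  P^T *m G *m P = 0 -> Q^T *m G *m Q = 0 -> P^T *m G *m Q = 1%:M ->
  exists P' Q' : 'M[Z2]_(2 + m, 1 + k), let G' := block_mx gram_H 0 0 G in
  [/\ P'^T *m G' *m P' = 0, Q'^T *m G' *m Q' = 0 & P'^T *m G' *m Q' = 1%:M].
Proof.
move=> PP QQ PQ.
exists (block_mx (delta_mx 0 0 : 'cV_2) 0 0 P).
exists (block_mx (delta_mx 1 0 : 'cV_2) 0 0 Q).
rewrite /= !block_gram PP QQ PQ !delta_gram !mxE /=.
by rewrite raddf0 block_mx0 -scalar_mx_block.
Qed.

Lemma gram_Hpow_frame k : exists P Q : 'M[Z2]_(k * 2, k),
  [/\ P^T *m gram_Hpow k *m P = 0, Q^T *m gram_Hpow k *m Q = 0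
    & P^T *m gram_Hpow k *m Q = 1%:M].
Proof.
elim: k => [|k [P [Q [PP QQ PQ]]]]; last exact: hyperbolic_frame_cons PP QQ PQ.
by exists 0, 0; split; apply/matrixP => -[].
Qed.

Lemma gram_main_frame n : exists P Q : 'M[Z2]_(n * 2 + 2, 1 + n),
  [/\ P^T *m gram_main n.+1 *m P = 0, P^T *m gram_main n.+1 *m Q = 1%:M
    & Q^T *m gram_main n.+1 *m Q = delta_mx 0 0].
Proof.
have [P [Q [PP QQ PQ]]] := gram_Hpow_frame n.
(* These are p_0 = (1, 1), which is isotropic, and q_0 = (1, 0), of norm 1. *)
pose u : 'cV[Z2]_2 := const_mx 1; pose v : 'cV[Z2]_2 := delta_mx 0 0.
have uu : u^T *m gram_1m1 *m u = 0.
  apply/matrixP => i j; rewrite !mxE !big_ord_recl big_ord0 !mxE.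
  by rewrite !big_ord_recl !big_ord0 !mxE /=; ring.
have uv : u^T *m gram_1m1 *m v = 1%:M.
  apply/matrixP => i j; rewrite !mxE !big_ord_recl big_ord0 !mxE.
  by rewrite !big_ord_recl !big_ord0 !mxE /= !ord1 eqxx; ring.
have vv : v^T *m gram_1m1 *m v = 1%:M by rewrite delta_gram !mxE.
exists (block_mx 0 P u 0), (block_mx 0 Q v 0).
rewrite /gram_main !tr_block_mx !mulmx_block !trmx0.
rewrite !(mul0mx, mulmx0, addr0, add0r) PP PQ QQ uu uv vv.
rewrite block_mx0 -scalar_mx_block; split=> //.
apply/matrixP => i j; rewrite -[i]splitK -[j]splitK.
case: (split i) => i'; case: (split j) => j' /=.
- by rewrite block_mxEul !mxE !ord1.
- by rewrite block_mxEur !mxE !ord1.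
- by rewrite block_mxEdl !mxE.
- by rewrite block_mxEdr !mxE.
Qed.

(** A matrix that is its own inverse has determinant of square 1, which later yields
    nondegeneracy. *)
Lemma gram_Hpow_unimodular k : (gram_Hpow k)^T = gram_Hpow k /\
  gram_Hpow k *m gram_Hpow k = 1%:M.
Proof.
elim: k => [|k [symH HH]]; first by split; apply/matrixP => -[].
have symH2 : gram_H^T = gram_H by apply/matrixP => i j; rewrite !mxE eq_sym.
have HH2 : gram_H *m gram_H = 1%:M.
  apply/matrixP => -[[|[|//]] ?] -[[|[|//]] ?];
  by rewrite !mxE !big_ord_recl big_ord0 !mxE /=; ring.
have tr_eq : (block_mx gram_H 0 0 (gram_Hpow k))^T = block_mx gram_H 0 0 (gram_Hpow k).
  by rewrite tr_block_mx !trmx0 symH2 symH.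
split; first exact: tr_eq.
have sq : block_mx gram_H 0 0 (gram_Hpow k) *m block_mx gram_H 0 0 (gram_Hpow k) = 1%:M.
  by rewrite mulmx_block !(mul0mx, mulmx0, addr0, add0r) HH2 HH -scalar_mx_block.
exact: sq.
Qed.

Lemma gram_main_lattice n : Z2_lattice_gram (gram_main n).
Proof.
have [symH HH] := gram_Hpow_unimodular n.-1.
have sym1 : gram_1m1^T = gram_1m1.
  by apply/matrixP => i j; rewrite !mxE eq_sym; case: eqP => // ->.
have sq1 : gram_1m1 *m gram_1m1 = 1%:M.
  apply/matrixP => -[[|[|//]] ?] -[[|[|//]] ?];
  by rewrite !mxE !big_ord_recl big_ord0 !mxE /=; ring.
split; first by rewrite /gram_main tr_block_mx !trmx0 symH sym1.
have : gram_main n *m gram_main n = 1%:M.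
  rewrite /gram_main mulmx_block !(mul0mx, mulmx0, addr0, add0r) HH sq1.
  by rewrite -scalar_mx_block.
move=> /(congr1 determinant); rewrite det_mulmx det1 => e d0.
by move/eqP: e; rewrite d0 mul0r eq_sym oner_eq0.
Qed.

Theorem theorem6p8 :
  forall n : nat, (5 <= n)%N ->
    prim_n_universal (gram_main n) n /\ u_star_Z2_is n (2 * n).
Proof.
move=> n n5; have [m ->] : exists m, n = (5 + m)%N.
  by exists (n - 5)%N; rewrite subnKC.
have univ : prim_n_universal (gram_main (5 + m)) (5 + m).
  have [P [Q [PP PQ QQ]]] := gram_main_frame (4 + m).
  exact: hyperbolic_frame_universal (proj1 (gram_main_lattice (5 + m))) PP PQ QQ.
split=> //; split; last by move=> r B; exact: prim_n_universal_rank_ge.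
have e : ((5 + m).-1 * 2 + 2 = 2 * (5 + m))%N by rewrite -mulSnr mulnC.
by rewrite -e; exists (gram_main (5 + m)); split=> //; exact: gram_main_lattice.
Qed.
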